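(* For $i,j,n\ge 0$ let $q(i,j,n)$ be the number of walks with $n$ steps, each in $\{(1,0),(-1,0),(0,1),(0,-1)\}$, that start at $(0,0)$, end at $(i,j)$, and stay in the quarter plane $\mathbb{Z}_+^2=\{0,1,2,\dots\}^2$, and let $Q(1,0,z)=\sum_{n\ge 0}\sum_{i\ge 0} q(i,0,n)z^n$. Then for every real $z$ with $0<z<1/4$, $$Q(1,0,z)=\frac{1}{2\pi}\int_{-1}^{1}\frac{1-2uz-\sqrt{(1-2uz)^2-4z^2}}{z^2}\,\sqrt{\frac{1+u}{1-u}}\,\mathrm{d}u .$$
   Context: The series converges for $|z|<1/4$ since the number of $n$-step walks is at most $4^n$. For $0<z<1/4$ and $u\in[-1,1]$ the quantity $(1-2uz)^2-4z^2$ is positive, and the square root is the positive one. *)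

(* Defs.v *)
From HB Require Import structures.
From mathcomp Require Import all_boot all_order all_algebra.
From mathcomp Require Import all_classical all_reals all_analysis.

Set Implicit Arguments.
Unset Strict Implicit.
Unset Printing Implicit Defensive.

Import Order.TTheory GRing.Theory Num.Theory.
Import numFieldNormedType.Exports.

Local Open Scope ring_scope.

Definition steps : seq (int * int) :=
  [:: (1, 0); (-1, 0); (0, 1); (0, -1)].

Definition quadrant (p : int * int) : bool := (0 <= p.1) && (0 <= p.2).

(* A walk is given by its sequence of steps; it starts at the origin. *)
Definition position (n : nat) (w : n.-tuple (seq_sub steps)) (k : nat) :
  int * int := \sum_(s <- take k w) ssval s.

Definition q (i j n : nat) : nat :=
  #|[set w : n.-tuple (seq_sub steps) |
      [forall k : 'I_n.+1, quadrant (position w k)]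
      && (position w n == (i%:Z, j%:Z))]|.

(* The series is summed in the extended reals, where it always has a value
   for z >= 0: equating it with a real number includes its convergence. *)
Definition Q10 (R : realType) (z : R) : \bar R :=
  (\sum_(0 <= n <oo) \sum_(0 <= i <oo) ((q i 0 n)%:R * z ^+ n)%:E)%E.

(* Main.v *)
(* Killing the walk at the boundary gives the neighbour-sum operator M on
   functions of (a, b), and \sum_i q(i,0,n) is (M^n 1_{b=0})(0,0).  Let U_a be
   the Chebyshev polynomials of the second kind and let T = T(u) be the root in
   [0, 1] of T = z (1 + 2uT + T^2).  Since U_{a+1} + U_{a-1} = 2u U_a, for every
   u the function U_a(u) T(u)^{b+1} / z solves g = U_a 1_{b=0} + z M g.
   Averaging over u against the weight sqrt((1+u)/(1-u)) / pi, for which every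
   U_a has mean 1, gives a solution I of I = 1_{b=0} + z M I, with
   |I(a,b)| <= (a+1)/z.  As M (a+1) <= 4 (a+1), iterating N times leaves a
   remainder of size at most (4z)^N / z, so I(0,0), which is the stated
   integral, is the sum of the series. *)
Require Import Defs.
From HB Require Import structures.
From mathcomp Require Import all_boot all_order all_algebra.
From mathcomp Require Import all_classical all_reals all_analysis.
From mathcomp Require Import measurable_realfun.
From mathcomp Require Import zify ring lra.

Import Order.TTheory GRing.Theory Num.Theory.
Import numFieldNormedType.Exports.

Local Open Scope classical_set_scope.
Local Open Scope ring_scope.

(** * The neighbour-sum operator *)

Definition quadrant_walks (n : nat) : {set n.-tuple (seq_sub steps)} :=
  [set w | [forall k : 'I_n.+1, quadrant (position w k)]].

(** The absolute values only turn coordinates into [nat]: the end of a quadrant walk has none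
    negative. By [walksum0] and [walksumS] this is the n-th power of [neighbor_sum], applied to [g]
    and evaluated at the origin. *)
Definition walksum {R : nzRingType} (n : nat) (g : nat -> nat -> R) : R :=
  \sum_(w in quadrant_walks n)
    g `|(position w n).1|%N `|(position w n).2|%N.

Definition neighbor_sum {R : nzRingType} (g : nat -> nat -> R) (a b : nat) : R :=
  g a.+1 b + (if a is a'.+1 then g a' b else 0)
  + g a b.+1 + (if b is b'.+1 then g a b' else 0).

Lemma position_rcons n (w : n.-tuple (seq_sub steps)) s k : (k <= n)%N ->
  position [tuple of rcons w s] k = position w k.
Proof.
move=> kn; rewrite /position /= -cats1 takel_cat ?size_tuple//.
Qed.

Lemma position_rcons_last n (w : n.-tuple (seq_sub steps)) s :
  position [tuple of rcons w s] n.+1 = position w n + ssval s.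
Proof.
rewrite /position !take_oversize ?size_tuple//=.
by rewrite -cats1 big_cat big_seq1.
Qed.

Lemma quadrant_walks_rcons n (w : n.-tuple (seq_sub steps)) s :
  ([tuple of rcons w s] \in quadrant_walks n.+1) =
  (w \in quadrant_walks n) && quadrant (position w n + ssval s).
Proof.
rewrite !inE; apply/forallP/andP => [H|[/forallP H1 H2] k].
  split; last by have := H ord_max; rewrite position_rcons_last.
  apply/forallP => k; have := H (widen_ord (leqnSn _) k).
  by rewrite position_rcons//= -ltnS.
have [kn|] := leqP k n.
  rewrite position_rcons//; exact: (H1 (Ordinal (kn : (k < n.+1)%N))).
rewrite ltnNge -ltnS => nk.
have -> : k = n.+1 :> nat by apply/eqP; rewrite eqn_leq -ltnS ltn_ord leqNgt.
by rewrite position_rcons_last.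
Qed.

Lemma sum_steps {R : nzRingType} (F : int * int -> R) :
  \sum_(s : seq_sub steps) F (ssval s) =
  F (1, 0) + F (-1, 0) + F (0, 1) + F (0, -1).
Proof.
transitivity (\sum_(s <- steps) F s); last first.
  by rewrite !big_cons big_nil addr0 !addrA.
rewrite -(big_map (@ssval _ steps) xpredT F).
apply: perm_big; apply: uniq_perm => //.
  by rewrite map_inj_uniq ?index_enum_uniq//; exact: val_inj.
move=> x; apply/mapP/idP => [[y _ ->]|xs]; first exact: valP.
by exists (SeqSub xs) => //; rewrite mem_index_enum.
Qed.

Lemma walksum0 {R : nzRingType} (g : nat -> nat -> R) : walksum 0 g = g 0%N 0%N.
Proof.
rewrite /walksum (big_pred1 [tuple]) => [|w].
  by rewrite /position big_nil.
rewrite [w]tuple0 [RHS]eqxx inE; apply/forallP => k.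
by rewrite /position /= big_nil.
Qed.

(** Splitting off the last step: appending a step is a bijection from pairs onto longer walks, and a
    step that leaves the quadrant contributes the 0 that [neighbor_sum] assigns to a missing
    neighbour. *)
Lemma walksumS {R : nzRingType} n (g : nat -> nat -> R) :
  walksum n.+1 g = walksum n (neighbor_sum g).
Proof.
pose f (x : n.-tuple (seq_sub steps) * seq_sub steps) :=
  [tuple of rcons x.1 x.2].
have fbij : bijective f.
  apply: inj_card_bij.
    move=> [w s] [w' s'] /(congr1 (@tval _ _)) /= /rcons_inj[ww ->].
    by congr pair; exact: val_inj.
  by rewrite card_prod !card_tuple expnSr.
rewrite /walksum (reindex f) /=; last exact: onW_bij.
rewrite (eq_bigl (fun x => (x.1 \in quadrant_walks n) &&
   quadrant (position x.1 n + ssval x.2))); last first.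
  by move=> [w s]; rewrite quadrant_walks_rcons.
rewrite -(pair_big_dep (fun w => w \in quadrant_walks n)
  (fun w s => quadrant (position w n + ssval s))
  (fun w s => g `|(position (f (w, s)) n.+1).1|%N
                `|(position (f (w, s)) n.+1).2|%N)) /=.
apply: eq_bigr => w; rewrite inE => /forallP/(_ ord_max) /=.
rewrite big_mkcond /=.
under eq_bigr do rewrite position_rcons_last.
set F := fun p : int * int => if quadrant (position w n + p) then
  g `|(position w n + p)%R.1|%N `|(position w n + p)%R.2|%N else 0.
rewrite (sum_steps F) {}/F.
case: (position w n) => [[a|a] [b|b]] //= _.
rewrite /neighbor_sum /quadrant /= !addr0.
congr (_ + _ + _ + _).
- by rewrite addn1 addn0.
- by case: a => [|a] //; rewrite (_ : a.+1%:Z - 1 = a) ?addn0//=; lia.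
- by rewrite addn1 addn0.
- by case: b => [|b] //; rewrite (_ : b.+1%:Z - 1 = b) ?addn0//=; lia.
Qed.

Lemma walksumD {R : nzRingType} n (g h : nat -> nat -> R) :
  walksum n (fun a b => g a b + h a b) = walksum n g + walksum n h.
Proof. exact: big_split. Qed.

Lemma walksumZ {R : nzRingType} n c (g : nat -> nat -> R) :
  walksum n (fun a b => c * g a b) = c * walksum n g.
Proof. by rewrite /walksum mulr_sumr. Qed.

Lemma walksum_ind {R : nzRingType} n (i j : nat) :
  walksum n (fun a b => ((a == i) && (b == j))%:R) = (q i j n)%:R :> R.
Proof.
rewrite /walksum -natr_sum; congr _%:R.
rewrite /q -sum1_card big_mkcond [RHS]big_mkcond; apply: eq_bigr => w _.
rewrite !inE; case: ifPn => //= /forallP /(_ ord_max) /=.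
case: (position w n) => [[a|a] [b|b]] //= _.
Qed.

Lemma sum_q {R : realType} n (z : R) : 0 <= z ->
  (\sum_(0 <= i <oo) ((q i 0 n)%:R * z ^+ n)%:E)%E =
  (walksum n (fun _ b => (b == 0%N)%:R) * z ^+ n)%:E.
Proof.
move=> z0.
(* [m] exceeds every first coordinate reached at time [n], so the terms with [i >= m] vanish and the
   series over [i] is a finite sum. *)
pose m := (\max_(w : n.-tuple (seq_sub steps)) `|(position w n).1|).+1.
rewrite (nneseries_split 0 m) => [|k _]; last by rewrite lee_fin mulr_ge0// exprn_ge0.
rewrite add0n eseries0 ?adde0; last first.
  move=> i mi _; rewrite -walksum_ind /walksum big1 ?mul0r// => w _.
  rewrite (_ : _ == i = false)//; apply: contraTF mi => /eqP <-.
  rewrite -ltnNge ltnS.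
  exact: (leq_bigmax (F := fun w : n.-tuple _ => `|(position w n).1|%N)).
rewrite sumEFin -mulr_suml; congr (_ * _)%:E.
under eq_bigr do rewrite -walksum_ind.
rewrite exchange_big /=; apply: eq_bigr => w _.
have wm : (`|(position w n).1| < m)%N.
  rewrite ltnS.
  exact: (leq_bigmax (F := fun w : n.-tuple _ => `|(position w n).1|%N)).
rewrite (bigD1_seq `|(position w n).1|%N) ?mem_index_iota ?iota_uniq//=.
rewrite eqxx big1 ?addr0// => i; rewrite eq_sym => /negbTE ->.
by [].
Qed.

(** * Chebyshev polynomials and the kernel root *)

Fixpoint cheb {R : nzRingType} (n : nat) : {poly R} :=
  match n with
  | 0 => 1
  | 1 => 'X *+ 2
  | (m.+1 as m').+1 => ('X *+ 2) * cheb m' - cheb m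
  end.

Lemma chebSS {R : nzRingType} n :
  cheb n.+2 = ('X *+ 2) * cheb n.+1 - cheb n :> {poly R}.
Proof. by []. Qed.

(** With x = cos t, this is the t-derivative of U_n(x) sin t = sin((n+1)t), combined with
    cos((n+1)t) = U_{n+1}(x) - x U_n(x). *)
Lemma deriv_cheb {R : comNzRingType} n :
  (1 - 'X^2) * (cheb n)^`() =
  n.+2%:R * 'X * cheb n - n.+1%:R * cheb n.+1 :> {poly R}.
Proof.
elim/ltn_ind: n => -[|[|n]] IH.
- by rewrite /= derivC; ring.
- by rewrite /= derivMn derivX; ring.
have := IH n (ltnW (ltnSn _)); have := IH n.+1 (ltnSn _).
rewrite !chebSS derivB derivM derivMn derivX.
set D := (cheb n.+1)^`(); set D' := (cheb n)^`().
move=> H1 H2.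
transitivity ((1 - 'X^2) * (2 * cheb n.+1) + ('X *+ 2) * ((1 - 'X^2) * D)
  - (1 - 'X^2) * D' : {poly R}); first by ring.
by rewrite H1 H2 -!natr1; ring.
Qed.

(** The recurrence map (x, y) -> (2Xx - y, x) preserves the quadratic form x^2 - 2Xxy + y^2. *)
Lemma chebyshev_pell {R : comNzRingType} n :
  cheb n.+1 ^+ 2 - ('X *+ 2) * cheb n.+1 * cheb n + cheb n ^+ 2 = 1 :> {poly R}.
Proof.
elim: n => [|n IH]; first by rewrite /=; ring.
by rewrite chebSS -[RHS]IH; ring.
Qed.

(** Completing the square in [chebyshev_pell] gives (x - uy)^2 + (1 - u^2) y^2 = 1 for consecutive
    values y, x, so |x - uy| <= 1 and the bound grows by at most 1 per index. *)
Lemma horner_cheb_le {R : realType} n (u : R) : -1 <= u <= 1 ->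
  `|(cheb n).[u]| <= n.+1%:R.
Proof.
move=> /andP[u1 u2].
have u2le : u ^+ 2 <= 1 by nra.
elim: n => [|n IH]; first by rewrite /= hornerC normr1.
have pell := congr1 (fun p : {poly R} => p.[u]) (chebyshev_pell (R := R) n).
rewrite !(hornerE, hornerMn, horner_exp) /= in pell.
set x := (cheb n.+1).[u] in pell *; set y := (cheb n).[u] in pell IH *.
have xuy : `|x - u * y| <= 1.
  rewrite -(ler_pXn2r (n := 2)) ?nnegrE// expr1n real_normK ?num_real//.
  have : 0 <= (1 - u ^+ 2) * y ^+ 2 by rewrite mulr_ge0 ?sqr_ge0// subr_ge0.
  by nra.
rewrite -natr1 (_ : x = u * y + (x - u * y)); last by ring.
apply: (le_trans (ler_normD _ _)); apply: lerD => //.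
rewrite normrM (le_trans _ IH)// ler_piMl//.
by rewrite ler_norml u1 u2.
Qed.

(* [(sqrt (1 - u^2) P)' = primitive_op P / sqrt (1 - u^2)]. *)
Definition primitive_op {R : nzRingType} (P : {poly R}) : {poly R} :=
  (1 - 'X^2) * P^`() - 'X * P.

Lemma primitive_opD {R : nzRingType} (P Q : {poly R}) :
  primitive_op (P + Q) = primitive_op P + primitive_op Q.
Proof. by rewrite /primitive_op derivD !mulrDr opprD addrACA. Qed.

(** The right-hand side is -T_{n+1}, with T_k the Chebyshev polynomials of the first kind. *)
Lemma primitive_op_cheb {R : numFieldType} n :
  primitive_op ((n.+1%:R^-1)%:P * cheb n) = 'X * cheb n - cheb n.+1 :> {poly R}.
Proof.
rewrite /primitive_op derivM derivC mul0r add0r.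
set c : {poly R} := _%:P.
have cn : c * n.+1%:R = 1.
  by rewrite /c -polyC1 -polyCMn -polyCM mulVf ?pnatr_eq0.
rewrite mulrCA deriv_cheb.
transitivity (c * n.+1%:R * ('X * cheb n - cheb n.+1)); last by rewrite cn; ring.
by rewrite -(natr1 n.+1); ring.
Qed.

(** The weight is (1 + u) / sqrt(1 - u^2) inside the interval, so U_n times the weight differs from
    1 / sqrt(1 - u^2) by the derivative of sqrt(1 - u^2) P, which vanishes at both ends. Hence all
    U_n have the same integral. *)
Lemma cheb_primitive {R : numFieldType} n : exists P : {poly R},
  primitive_op P = 1 - cheb n * (1 + 'X).
Proof.
elim/ltn_ind: n => -[|[|n]] IH.
- by exists 1; rewrite /primitive_op derivC /=; ring.
- by exists (2%:P + 'X); rewrite /primitive_op derivD derivC derivX /= polyCMn; ring.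
have [|P HP] := IH n; first by [].
(* From U_{n+2} - U_n = 2 T_{n+2} follows (U_{n+2} - U_n)(1 + X) = T_{n+1} + 2 T_{n+2} + T_{n+3};
   the added terms are the primitives of these given by [primitive_op_cheb]. *)
exists (P + (n.+1%:R^-1)%:P * cheb n + (n.+2%:R^-1)%:P * cheb n.+1
  + (n.+2%:R^-1)%:P * cheb n.+1 + (n.+3%:R^-1)%:P * cheb n.+2).
by rewrite !primitive_opD HP !primitive_op_cheb !chebSS; ring.
Qed.

(** For nonzero z, the roots of z t^2 - (1 - 2uz) t + z have product 1; the minus sign before the
    square root selects the smaller one. *)
Definition kernel_root {R : rcfType} (z u : R) : R :=
  (1 - 2 * u * z - Num.sqrt ((1 - 2 * u * z) ^+ 2 - 4 * z ^+ 2)) / (2 * z).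

Lemma kernel_discr_ge0 {R : rcfType} (z u : R) : 0 < z -> z < 1 / 4 -> -1 <= u <= 1 ->
   0 <= (1 - 2 * u * z) ^+ 2 - 4 * z ^+ 2.
Proof.
move=> hz0 hz1 /andP[u1 u2].
have uz : u * z <= z by rewrite ger_pMl.
rewrite (_ : 4 * z ^+ 2 = (2 * z) ^+ 2); last by ring.
rewrite subr_sqr.
by rewrite mulr_ge0//; lra.
Qed.

Lemma kernel_rootE {R : rcfType} (z u : R) : 0 < z -> z < 1 / 4 -> -1 <= u <= 1 ->
  kernel_root z u = z * (1 + 2 * u * kernel_root z u + kernel_root z u ^+ 2).
Proof.
move=> hz0 hz1 hu; rewrite /kernel_root.
have := sqr_sqrtr (kernel_discr_ge0 _ _ hz0 hz1 hu); set s := Num.sqrt _ => hs.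
have z0 : z != 0 by rewrite gt_eqF.
(* A multiple of the vanishing quantity [hs] is added, scaled so that the rest is a rational
   identity in [s]. *)
transitivity ((1 - 2 * u * z - s) / (2 * z) + (s ^+ 2 - ((1 - 2 * u * z) ^+ 2 - 4 * z ^+ 2)) / (4 * z)).
  by rewrite hs subrr mul0r addr0.
by field.
Qed.

(** With w = 1 - 2uz and s the square root, the bounds say w - 2z <= s <= w; both follow from s^2 =
    (w - 2z)(w + 2z) and w >= 2z. *)
Lemma kernel_root_itv {R : rcfType} (z u : R) : 0 < z -> z < 1 / 4 -> -1 <= u <= 1 -> 0 <= kernel_root z u <= 1.
Proof.
move=> hz0 hz1 hu; rewrite /kernel_root.
have hs := sqr_sqrtr (kernel_discr_ge0 _ _ hz0 hz1 hu).
have s0 := sqrtr_ge0 ((1 - 2 * u * z) ^+ 2 - 4 * z ^+ 2).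
move: hs s0; set s := Num.sqrt _; set w := 1 - 2 * u * z => hs s0.
have uz : u * z <= z by case/andP: hu => _ u1; rewrite ger_pMl.
have w2 : 2 * z <= w by rewrite /w; lra.
rewrite ler_pdivlMr ?ler_pdivrMr ?mulr_gt0// mul0r mul1r subr_ge0.
have ws : s <= w by rewrite -(ler_pXn2r (n := 2)) ?nnegrE ?hs//; nra.
suff : w - 2 * z <= s by move=> h; rewrite ws; lra.
rewrite -(ler_pXn2r (n := 2)) ?nnegrE ?subr_ge0// hs.
by have : 0 <= (w - 2 * z) * z; [rewrite mulr_ge0 ?subr_ge0// ltW|nra].
Qed.

(** Continuity holds on the whole line because [Num.sqrt] is continuous everywhere, being 0 on
    negative numbers. *)
Lemma continuous_kernel_root {R : realType} (z : R) : continuous (kernel_root z).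
Proof.
move=> u; rewrite /kernel_root; apply: cvgMl.
have H : (fun t => 1 - 2 * t * z) t @[t --> u] --> 1 - 2 * u * z.
  by apply: cvgB; [exact: cvg_cst|]; apply: cvgMl; apply: cvgMr.
apply: cvgB => //.
apply: (@continuous_comp R R R (fun t => (1 - 2 * t * z) ^+ 2 - 4 * z ^+ 2) Num.sqrt u); last exact: sqrt_continuous.
apply: cvgB; last exact: cvg_cst.
rewrite !expr2; exact: cvgM.
Qed.

(** * The weight *)

Section weight.
Context {R : realType}.
Notation mu := (@lebesgue_measure R).
Implicit Types (u : R) (f g : R -> R).

Definition weight u : R := Num.sqrt ((1 + u) / (1 - u)).

Lemma weight_ge0 u : 0 <= weight u. Proof. exact: sqrtr_ge0. Qed.

Lemma continuous_weight u : u < 1 -> {for u, continuous weight}.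
Proof.
move=> u1.
apply: (@continuous_comp R R R (fun t => (1 + t) / (1 - t)) Num.sqrt u).
  apply: cvgM; first by apply: cvgD; [exact: cvg_cst|exact: cvg_id].
  apply: cvgV; first by rewrite gt_eqF// subr_gt0.
  by apply: cvgB; [exact: cvg_cst|exact: cvg_id].
exact: sqrt_continuous.
Qed.

Lemma measurable_weight : measurable_fun `[(-1 : R), 1] weight.
Proof.
(* Endpoints do not affect measurability, so the discontinuity at [1] is discarded first. *)
apply: (@measurable_fun_itv_cc _ _ _ false true).
apply: subspace_continuous_measurable_fun => //.
rewrite continuous_open_subspace; last exact: interval_open.
by move=> u; rewrite inE/= in_itv/= => /andP[_ u1]; exact: continuous_weight.
Qed.

(* [weight 1 = 0] by the convention [x / 0 = 0], so the value of this function at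
   [1] is not its limit there. *)
Definition weight_antideriv (P : {poly R}) u : R :=
  2 * atan (weight u) - Num.sqrt (1 - u ^+ 2) * P.[u].

Lemma is_derive_weight u : -1 < u < 1 ->
  is_derive u 1 weight (weight u / (1 - u ^+ 2)).
Proof.
move=> /andP[u0 u1].
have v0 : 0 < 1 - u by rewrite subr_gt0.
have w0 : 0 < (1 + u) / (1 - u) by rewrite divr_gt0//; lra.
have d1 : is_derive u (1 : R) (fun t : R => (1 - t)^-1) ((1 - u) ^- 2).
  apply: trigger_derive; first by apply: is_deriveV; rewrite gt_eqF.
  by rewrite add0r mul1r scaleNr /GRing.scale/= mulrN1 opprK.
have d2 : is_derive u (1 : R) (fun t : R => (1 + t) * (1 - t)^-1) (2 / (1 - u) ^+ 2).
  apply: trigger_derive.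
  rewrite add0r /GRing.scale/=; field.
  by rewrite gt_eqF.
have d3 := is_derive1_sqrt w0.
apply: (trigger_derive (is_derive1_comp (g := fun t : R => (1 + t) / (1 - t)) d3 d2)).
rewrite -/(weight u) /GRing.scale/=.
have ww : weight u ^+ 2 = (1 + u) / (1 - u) by rewrite sqr_sqrtr// ltW.
have weq0 : weight u != 0 by rewrite gt_eqF// sqrtr_gt0.
have {2}-> : weight u = (1 + u) / (1 - u) / weight u by rewrite -ww expr2 mulfK.
have : 1 - u ^+ 2 != 0 by rewrite gt_eqF//; nra.
by move=> h1; field; rewrite weq0 h1 gt_eqF.
Qed.

Lemma is_derive_semicircle u : -1 < u < 1 ->
  is_derive u 1 (fun t => Num.sqrt (1 - t ^+ 2)) (- u / Num.sqrt (1 - u ^+ 2)).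
Proof.
move=> /andP[u0 u1].
have w0 : 0 < 1 - u ^+ 2 by nra.
have d2 : is_derive u (1 : R) (fun t : R => (1 - t ^+ 2)) (- (2 * u)).
  apply: trigger_derive.
  rewrite /GRing.scale/=; ring.
have d3 := is_derive1_sqrt w0.
apply: (trigger_derive (is_derive1_comp (g := fun t : R => 1 - t ^+ 2) d3 d2)).
rewrite /GRing.scale/=; field.
by rewrite gt_eqF// sqrtr_gt0.
Qed.

Lemma weightE u : -1 < u < 1 ->
  Num.sqrt (1 - u ^+ 2) = weight u * (1 - u).
Proof.
move=> /andP[u0 u1]; have v0 : 0 < 1 - u by rewrite subr_gt0.
have -> : 1 - u ^+ 2 = (1 + u) / (1 - u) * (1 - u) ^+ 2.
  by field; rewrite gt_eqF.
by rewrite sqrtrM ?divr_ge0 ?sqrtr_sqr ?gtr0_norm//; lra.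
Qed.

(** Since 1 + weight^2 = 2 / (1 - u), the arctangent term has derivative 1 / sqrt(1 - u^2); the
    hypothesis on [P] says what the other term subtracts. *)
Lemma is_derive_weight_antideriv (n : nat) (P : {poly R}) u :
  primitive_op P = 1 - cheb n * (1 + 'X) -> -1 < u < 1 ->
  is_derive u 1 (weight_antideriv P) ((cheb n).[u] * weight u).
Proof.
move=> HP hu; have [u0 u1] := andP hu.
have d1 := is_derive_weight _ hu.
have d2 := is_derive_semicircle _ hu.
have d3 := is_derive1_comp (g := weight) (is_derive1_atan (weight u)) d1.
have d4 : is_derive u (1 : R) (fun t : R => P.[t]) P^`().[u] by exact: is_derive_poly.
apply: trigger_derive.
have := congr1 (fun p : {poly R} => p.[u]) HP.
rewrite /primitive_op !(hornerE, hornerMn, horner_exp) /= => HPu.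
rewrite weightE// /GRing.scale/=.
have v0 : 0 < 1 - u by rewrite subr_gt0.
have v1 : 0 < 1 + u by lra.
have ww : weight u ^+ 2 = (1 + u) / (1 - u) by rewrite sqr_sqrtr// divr_ge0// ltW.
have weq0 : weight u != 0 by rewrite gt_eqF// sqrtr_gt0 divr_gt0.
have -> : (1 + weight u ^+ 2)^-1 = (1 - u) / 2.
  by rewrite ww; field; rewrite gt_eqF//= (_ : 1 - u + (1 + u) = 2) ?pnatr_eq0//; ring.
have -> : - u / (weight u * (1 - u)) = - u * weight u / (1 + u).
  have -> : 1 + u = weight u ^+ 2 * (1 - u) by rewrite ww mulfVK// gt_eqF.
  by field; rewrite weq0 gt_eqF.
have -> : (cheb n).[u] = (1 - ((1 - u ^+ 2) * P^`().[u] - u * P.[u])) / (1 + u).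
  by rewrite HPu; field; rewrite gt_eqF.
have -> : 1 - u ^+ 2 = (1 - u) * (1 + u) by ring.
by field; rewrite !gt_eqF.
Qed.

Lemma continuous_weight_antideriv (P : {poly R}) u : u < 1 ->
  {for u, continuous (weight_antideriv P)}.
Proof.
move=> u1; apply: cvgB.
  apply: cvgMr; apply: (@continuous_comp R R R weight atan u).
    exact: continuous_weight.
  exact: continuous_atan.
apply: cvgM; last exact: continuous_horner.
apply: (@continuous_comp R R R (fun t => 1 - t ^+ 2) Num.sqrt u).
  by apply: cvgB; [exact: cvg_cst|exact: exprn_continuous].
exact: sqrt_continuous.
Qed.

(** The fundamental theorem of calculus is applied short of the singularity at 1; the antiderivative
    vanishes at -1, where both the weight and the semicircle factor are 0. *)
Lemma integral_cheb_weight_lt (n : nat) (P : {poly R}) (c : R) :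
  primitive_op P = 1 - cheb n * (1 + 'X) -> -1 < c < 1 ->
  (\int[mu]_(u in `[(-1)%R, c]) ((cheb n).[u] * weight u)%:E =
   (weight_antideriv P c)%:E)%E.
Proof.
move=> HP /andP[c0 c1].
have H u : u \in `]-1, c[ -> is_derive u 1 (weight_antideriv P) ((cheb n).[u] * weight u).
  rewrite in_itv/= => /andP[u0 u1]; apply: is_derive_weight_antideriv => //.
  by rewrite u0 (lt_trans u1).
rewrite (@continuous_FTC2 _ _ (weight_antideriv P))//.
- rewrite [X in (_ - X%:E)%E](_ : _ = 0) ?sube0//.
  by rewrite /weight_antideriv /weight subrr mul0r sqrtr0 atan0 sqrrN expr1n subrr sqrtr0 mulr0 mul0r subr0.
- apply/subspace_continuousP => u /=; rewrite in_itv/= => /andP[u0 u1].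
  apply: cvg_within_filter; apply: cvgM; first exact: continuous_horner.
  by apply: continuous_weight; exact: le_lt_trans c1.
- split.
  + by move=> u /H [].
  + by apply: cvg_at_right_filter; apply: continuous_weight_antideriv; lra.
  + by apply: cvg_at_left_filter; exact: continuous_weight_antideriv.
- by move=> u /H dF; rewrite derive1E; exact: derive_val.
Qed.

(** Monotone convergence along the intervals [-1, 1 - 1/(i+1)]: on each the integral is explicit and
    at most pi. *)
Lemma integrable_weight : mu.-integrable `[-1, 1] (EFin \o weight).
Proof.
apply/integrableP; split.
  by apply/measurable_EFinP; exact: measurable_weight.
under eq_integral do rewrite /= ger0_norm ?weight_ge0//.
have mw : measurable_fun `[(-1 : R), 1[ (EFin \o weight).
  apply/measurable_EFinP; apply: measurable_funS measurable_weight => //.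
  exact: subset_itv_co_cc.
rewrite -integral_itv_bndo_bndc//.
rewrite itv_bnd_open_bigcup.
have sub i : `[(-1 : R), 1 - i.+1%:R^-1]%classic `<=` `[(-1 : R), 1[%classic.
  apply: subset_itvl; rewrite bnd_simp/= ltrBlDr ltrDl invr_gt0//.
have cv : (\int[mu]_(u in `[(-1 : R)%R, (1 - i.+1%:R^-1)%R]) (weight u)%:E)%E @[i --> \oo]
    --> (\int[mu]_(u in \bigcup_i `[(-1 : R)%R, (1 - i.+1%:R^-1)%R]%classic) (weight u)%:E)%E.
  apply: ge0_nondecreasing_set_cvg_integral => //.
  - apply/nondecreasing_seqP => i; rewrite subsetEset; apply: subset_itvl.
    by rewrite bnd_simp lerD2l lerN2 lef_pV2 ?posrE// ler_nat.
  - by move=> i; apply: measurable_funS mw.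
  - by move=> i u _; rewrite lee_fin weight_ge0.
rewrite -(cvg_lim _ cv)//.
apply: (@le_lt_trans _ _ pi%:E); last exact: ltry.
apply: lime_le; first exact: cvgP cv.
apply: nearW => i.
(* The weight alone is the case U_0 = 1, with [P] equal to 1. *)
have HP : primitive_op 1 = 1 - cheb 0 * (1 + 'X) :> {poly R}.
  by rewrite /primitive_op derivC /=; ring.
have i0 : 0 < (i.+1%:R : R)^-1 by rewrite invr_gt0.
have i1 : (i.+1%:R : R)^-1 <= 1 by rewrite invf_le1// ler1n.
rewrite [leLHS](_ : _ = (weight_antideriv 1 (1 - i.+1%:R^-1))%:E) ?lee_fin.
  rewrite /weight_antideriv hornerC mulr1 lerBlDr.
  rewrite (@le_trans _ _ pi) ?lerDl ?sqrtr_ge0//.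
  by rewrite mulrC -ler_pdivlMr// ltW// atan_ltpi2.
rewrite -(integral_cheb_weight_lt _ _ _ HP); last first.
  by rewrite ltrBlDr ltrDl i0 (@lt_le_trans _ _ 0) ?ltrN10 ?subr_ge0.
by apply: eq_integral => u _; rewrite /= hornerC mul1r.
Qed.

Lemma weight_cvg_at_left : weight u @[u --> 1^'-] --> +oo.
Proof.
apply/cvgryPgt => A; near=> u.
have u1 : u < 1 by near: u; exact: nbhs_left_lt.
have u0 : 0 < u by near: u; exact: nbhs_left_gt.
(* The threshold gives (1 - u)(1 + A^2) < 1, hence A^2 (1 - u) < u < 1 + u. *)
have uA : 1 - (1 + A ^+ 2)^-1 < u.
  by near: u; apply: nbhs_left_gt; rewrite ltrBlDr ltrDl invr_gt0; nra.
rewrite (le_lt_trans (ler_norm A))// -sqrtr_sqr ltr_sqrt ?divr_gt0//; [|lra|lra].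
rewrite ltr_pdivlMr ?subr_gt0//.
have : (1 - u) * (1 + A ^+ 2) < 1.
  by rewrite -ltr_pdivlMr ?div1r; [lra|nra].
nra.
Unshelve. all: by end_near. Qed.

(** The arctangent tends to pi / 2 and the semicircle factor kills [P], so the limit is the same for
    every [P]. *)
Lemma weight_antideriv_cvg (P : {poly R}) :
  weight_antideriv P u @[u --> 1^'-] --> pi.
Proof.
rewrite [X in _ --> X](_ : _ = 2 * (pi / 2) - 0 * P.[1]); last by field.
apply: cvgB.
  apply: cvgMr; apply: cvg_comp weight_cvg_at_left _; exact: cvgy_atan.
apply: cvgM; last by apply: cvg_at_left_filter; exact: continuous_horner.
apply: cvg_at_left_filter.
have -> : 0 = Num.sqrt (1 - 1 ^+ 2) :> R by rewrite expr1n subrr sqrtr0.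
apply: (@continuous_comp R R R (fun t => 1 - t ^+ 2) Num.sqrt 1).
  by apply: cvgB; [exact: cvg_cst|exact: exprn_continuous].
exact: sqrt_continuous.
Qed.

Lemma integrable_mul_weight f : continuous f ->
  mu.-integrable `[-1, 1] (EFin \o (fun u => f u * weight u)).
Proof.
move=> cf.
have -> : EFin \o (fun u => f u * weight u) = ((EFin \o f) \* (EFin \o weight))%E.
  by apply/funext => u /=; rewrite EFinM.
apply: integrableMr => //.
- by apply: measurable_funTS; exact: continuous_measurable_fun.
- have := compact_bounded (continuous_compact
     (continuous_subspaceT cf) (@segment_compact R (-1) 1)).
  move=> [M [Mr HM]]; exists M; split => // x Mx u uI /=.
  by apply: (HM x Mx); exists u.
- exact: integrable_weight.
Qed.

(** The integral up to [c] is followed as [c] tends to 1 from the left, once by integrability and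
    once through the antiderivative. *)
Lemma integral_cheb_weight n :
  \int[mu]_(u in `[-1, 1]) ((cheb n).[u] * weight u) = pi.
Proof.
have [P HP] := cheb_primitive (R := R) n.
have m11 : (-1 : R) < 1 by lra.
have cvI := parameterized_integral_cvg_at_left m11
   (integrable_mul_weight _ (@continuous_horner _ (cheb n))).
apply: (cvg_unique _ cvI) => //.
apply: cvg_trans (weight_antideriv_cvg P).
apply: near_eq_cvg; near=> c.
rewrite /parameterized_integral /Rintegral (integral_cheb_weight_lt _ _ _ HP)//.
apply/andP; split; near: c; [exact: nbhs_left_gt|exact: nbhs_left_lt].
Unshelve. all: by end_near. Qed.

End weight.

(** * Averaged kernel solutions *)

Lemma walksum_le {R : numDomainType} n (g h : nat -> nat -> R) :
  (forall a b, g a b <= h a b) -> walksum n g <= walksum n h.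
Proof. by move=> gh; exact: ler_sum. Qed.

(* [a + 1] is superharmonic for the walk killed at the boundary. *)
Lemma walksum_succ_le {R : numDomainType} n :
  walksum n (fun a _ => a.+1%:R) <= 4 ^+ n :> R.
Proof.
elim: n => [|n IH]; first by rewrite walksum0 expr0.
rewrite walksumS exprS (le_trans _ (ler_wpM2l _ IH))//.
rewrite -walksumZ; apply: walksum_le => a b.
rewrite -natrM; case: a => [|a]; case: b => [|b]; rewrite /neighbor_sum ?addr0 -?natrD ler_nat; lia.
Qed.

Section transform.
Context {R : realType} (z : R).
Notation mu := (@lebesgue_measure R).
Implicit Types f g : R -> R.

Definition weight_mean f : R :=
  pi^-1 * \int[mu]_(u in `[-1, 1]) (f u * weight u).

Lemma weight_meanD f g : continuous f -> continuous g ->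
  weight_mean (fun u => f u + g u) = weight_mean f + weight_mean g.
Proof.
move=> cf cg; rewrite /weight_mean -mulrDr -RintegralD//.
- by congr (_ * _); apply: eq_Rintegral => u _; rewrite mulrDl.
- exact: integrable_mul_weight.
- exact: integrable_mul_weight.
Qed.

Lemma weight_meanZ c f : continuous f ->
  weight_mean (fun u => c * f u) = c * weight_mean f.
Proof.
move=> cf; rewrite /weight_mean mulrCA; congr (_ * _).
rewrite -RintegralZl//; last exact: integrable_mul_weight.
by apply: eq_Rintegral => u _; rewrite mulrA.
Qed.

Lemma eq_weight_mean f g : (forall u, -1 <= u <= 1 -> f u = g u) ->
  weight_mean f = weight_mean g.
Proof.
move=> fg; congr (_ * _); apply: eq_Rintegral => u.
by rewrite inE/= in_itv/= => /fg ->.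
Qed.

Lemma weight_mean_cheb n : weight_mean (fun u => (cheb n).[u]) = 1.
Proof. by rewrite /weight_mean integral_cheb_weight mulVf// gt_eqF// pi_gt0. Qed.

Lemma weight_mean_le f c : continuous f -> 
  (forall u, -1 <= u <= 1 -> `|f u| <= c) -> `|weight_mean f| <= c.
Proof.
move=> cf fc.
have pi0 : 0 < (pi : R) := pi_gt0 R.
rewrite /weight_mean normrM gtr0_norm ?invr_gt0// ler_pdivrMl//.
have cc : continuous (cst c : R -> R) by move=> u; exact: cvg_cst.
(* The constant is written as an integral against the weight, whose total mass pi is the case U_0 =
   1. *)
have -> : pi * c = \int[mu]_(u in `[-1, 1]) (c * weight u).
  rewrite -(integral_cheb_weight 0) mulrC -RintegralZl//; last first.
    exact: integrable_mul_weight (@continuous_horner _ _).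
  by apply: eq_Rintegral => u _; rewrite /= hornerC mul1r.
apply: le_trans (le_normr_Rintegral _ _) _ => //.
  exact: integrable_mul_weight.
apply: le_Rintegral => //.
- have := integrable_abse (integrable_mul_weight _ cf).
  by [].
- exact: integrable_mul_weight.
- move=> u /=; rewrite in_itv/= => uI.
  by rewrite normrM (ger0_norm (weight_ge0 _)) ler_wpM2r ?weight_ge0// fc.
Qed.

Lemma weight_mean_neighbor (F : nat -> nat -> R -> R) a b :
  (forall a b, continuous (F a b)) ->
  weight_mean (fun u => neighbor_sum (fun a b => F a b u) a b) =
  neighbor_sum (fun a b => weight_mean (F a b)) a b.
Proof.
move=> cF.
have c0 : continuous (fun _ : R => 0 : R) by move=> u; exact: cvg_cst.
have m0 : weight_mean (fun _ => 0) = 0.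
  rewrite -[RHS](mul0r (weight_mean (fun _ => 0))) -weight_meanZ//.
  by apply: eq_weight_mean => u _; rewrite mul0r.
rewrite /neighbor_sum; case: a => [|a]; case: b => [|b];
  rewrite !weight_meanD ?m0//; move=> u; repeat apply: cvgD; first [exact: cF | exact: c0].
Qed.

Definition kernel_mode (a b : nat) (u : R) : R :=
  (cheb a).[u] * (kernel_root z u ^+ b.+1 / z).

Lemma continuous_kernel_mode a b : continuous (kernel_mode a b).
Proof.
move=> u; apply: cvgM; first exact: continuous_horner.
apply: cvgMl.
apply: (@continuous_comp R R R (kernel_root z) (fun t => t ^+ b.+1) u).
  exact: continuous_kernel_root.
exact: exprn_continuous.
Qed.

(** The horizontal neighbours add up to 2u U_a, also at a = 0 where U_{-1} = 0, and the equation of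
    the root then closes the sum. At b = 0 the killed neighbour would have contributed z U_a T^0 / z
    = U_a, which is the source term. *)
Lemma kernel_modeE a b u : 0 < z -> z < 1 / 4 -> -1 <= u <= 1 ->
  kernel_mode a b u = (b == 0)%N%:R * (cheb a).[u]
    + z * neighbor_sum (fun a b => kernel_mode a b u) a b.
Proof.
move=> hz0 hz1 hu; rewrite /neighbor_sum /kernel_mode.
have z0 : z != 0 by rewrite gt_eqF.
have chebu : (cheb a.+1).[u] + (if a is a'.+1 then (cheb a').[u] else 0)
     = 2 * u * (cheb a).[u].
  case: a => [|a]; first by rewrite /= hornerMn hornerX hornerC; ring.
  by rewrite chebSS !(hornerE, hornerMn); ring.
have rootE := kernel_rootE _ _ hz0 hz1 hu.
set t := kernel_root z u in rootE *.
have -> : (if a is a'.+1 then (cheb a').[u] * (t ^+ b.+1 / z) else 0) =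
    (if a is a'.+1 then (cheb a').[u] else 0) * (t ^+ b.+1 / z).
  by case: a {chebu} => [|a]; rewrite ?mul0r.
rewrite -mulrDl chebu.
case: b => [|b].
  rewrite /= mul1r {1}expr1 {1}rootE; field.
  exact: z0.
rewrite /= mul0r add0r.
rewrite {1}exprS {1}rootE !exprS; field.
exact: z0.
Qed.

Lemma kernel_mode_le a b u : 0 < z -> z < 1 / 4 -> -1 <= u <= 1 ->
  `|kernel_mode a b u| <= z^-1 * a.+1%:R.
Proof.
move=> hz0 hz1 hu; rewrite /kernel_mode mulrA normrM (gtr0_norm (_ : 0 < z^-1)) ?invr_gt0//.
rewrite mulrC ler_pM2l ?invr_gt0// normrM.
rewrite (le_trans _ (horner_cheb_le a _ hu))// ler_piMr//.
have /andP[t0 t1] := kernel_root_itv _ _ hz0 hz1 hu.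
by rewrite normrX exprn_ile1 ?ger0_norm.
Qed.

(** Averaging [kernel_modeE] replaces the source U_a by its mean 1, so the dependence of the source
    on [a] disappears. *)
Lemma weight_mean_kernel_mode a b : 0 < z -> z < 1 / 4 ->
  weight_mean (kernel_mode a b) =
  (b == 0)%N%:R + z * neighbor_sum (fun a b => weight_mean (kernel_mode a b)) a b.
Proof.
move=> hz0 hz1.
rewrite (eq_weight_mean _ _ (fun u => kernel_modeE a b u hz0 hz1)).
have cN : continuous (fun u => neighbor_sum (fun a b => kernel_mode a b u) a b).
  have c0 : continuous (fun _ : R => 0 : R) by move=> u; exact: cvg_cst.
  move=> u; rewrite /neighbor_sum.
  case: a => [|a]; case: b => [|b]; do ![apply: cvgD]; 
  solve [exact: continuous_kernel_mode | exact: c0].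
have cU : continuous (fun u : R => (cheb a).[u]) by exact: continuous_horner.
rewrite weight_meanD ?weight_meanZ ?weight_mean_cheb ?mulr1 ?weight_mean_neighbor//.
- exact: continuous_kernel_mode.
- by move=> u; apply: cvgMr; exact: cU.
- by move=> u; apply: cvgMr; exact: cN.
Qed.

End transform.

(** * Summation of the series by iterating the averaged equation *)

Theorem proposition3p3 (R : realType) (z : R) (hz0 : 0 < z) (hz1 : z < 1 / 4) :
  Q10 z =
  (1 / (2 * pi) *
   \int[@lebesgue_measure R]_(u in `[-1, 1])
     ((1 - 2 * u * z - Num.sqrt ((1 - 2 * u * z) ^+ 2 - 4 * z ^+ 2)) / z ^+ 2
      * Num.sqrt ((1 + u) / (1 - u))))%:E.
Proof.
pose I a b := weight_mean (kernel_mode z a b).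
have SI n : walksum n I = walksum n (fun _ b => (b == 0)%N%:R) + z * walksum n.+1 I.
  rewrite walksumS -walksumZ -walksumD; apply: eq_bigr => w _.
  exact: weight_mean_kernel_mode.
(* Iterating [SI] from the origin: a partial sum of the series plus a remainder. *)
have I00 N : I 0%N 0%N =
    \sum_(0 <= n < N) walksum n (fun _ b => (b == 0)%N%:R) * z ^+ n
    + z ^+ N * walksum N I.
  elim: N => [|N ->]; first by rewrite big_nil walksum0 mul1r add0r.
  by rewrite SI big_nat_recr//= exprSr; ring.
have SIle N : `|z ^+ N * walksum N I| <= z^-1 * (4 * z) ^+ N.
  rewrite normrM (ger0_norm (exprn_ge0 _ (ltW hz0))) exprMn mulrA [leRHS]mulrC.
  rewrite ler_pM2l ?exprn_gt0//.
  apply: (le_trans (ler_norm_sum _ _ _)).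
  apply: (@le_trans _ _ (walksum N (fun a _ => z^-1 * a.+1%:R))).
    apply: ler_sum => w _; apply: weight_mean_le; first exact: continuous_kernel_mode.
    by move=> u hu; exact: kernel_mode_le.
  by rewrite walksumZ ler_wpM2l ?invr_ge0 ?(ltW hz0)// walksum_succ_le.
have -> : 1 / (2 * pi) *
   \int[@lebesgue_measure R]_(u in `[-1, 1])
     ((1 - 2 * u * z - Num.sqrt ((1 - 2 * u * z) ^+ 2 - 4 * z ^+ 2)) / z ^+ 2
      * Num.sqrt ((1 + u) / (1 - u))) = I 0%N 0%N.
  (* As U_0 = 1, [kernel_mode z 0 0] is T / z, whose denominator is 2 z^2; twice it is the stated
     integrand without the weight. *)
  transitivity (2^-1 * weight_mean (fun u => 2 * kernel_mode z 0 0 u)); last first.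
    by rewrite weight_meanZ ?mulKf ?pnatr_eq0//; exact: continuous_kernel_mode.
  rewrite /weight_mean mulrA mul1r invfM; congr (_ * _).
  apply: eq_Rintegral => u _; congr (_ * _).
  by rewrite /kernel_mode /kernel_root /= hornerC mul1r expr1; field; rewrite gt_eqF.
rewrite /Q10 (eq_eseriesr (fun n _ => sum_q n _ (ltW hz0))).
apply/cvg_lim => //.
under eq_fun do rewrite sumEFin.
apply: cvg_EFin; first exact: nearW.
(* By [I00] the partial sums are the claimed value minus the remainder, which [SIle] squeezes to 0
   because 4z < 1. *)
rewrite (_ : fine \o _ = fun N => I 0%N 0%N - z ^+ N * walksum N I); last first.
  by apply/funext => N /=; rewrite (I00 N) addrK.
rewrite -[X in _ --> X]subr0; apply: cvgB; first exact: cvg_cst.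
apply/norm_cvg0P.
apply: (@squeeze_cvgr _ _ _ _ (fun=> 0) (fun N => z^-1 * (4 * z) ^+ N)).
- by apply: nearW => N; rewrite normr_ge0 SIle.
- exact: cvg_cst.
- rewrite -[X in _ --> X](mulr0 z^-1); apply: cvgMr; apply: cvg_expr.
  by rewrite gtr0_norm ?mulr_gt0//; lra.
Qed.
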